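(* Let $\alpha_0,\dots,\alpha_4$ be complex parameters with $\alpha_0+\alpha_1+2\alpha_2+\alpha_3+\alpha_4=1$. For the system of type $D_4^{(1)}$ $$\frac{dx}{dt}=\frac{2x^2y-x^2+(\alpha_0+\alpha_1)x-2w}{t}+1,\qquad \frac{dy}{dt}=\frac{-2xy^2+2xy-(\alpha_0+\alpha_1)y+\alpha_1}{t},$$ $$\frac{dz}{dt}=\frac{2z^2w-tz^2-(1-\alpha_3-\alpha_4)z+1-2y}{t},\qquad \frac{dw}{dt}=\frac{-2zw^2+2tzw+(1-\alpha_3-\alpha_4)w+\alpha_3t}{t},$$ make the change of parameters and variables $$A_0=\frac{\alpha_0-\alpha_1}{2},\quad A_1=\alpha_1,\quad A_2=\alpha_2,\quad A_3=\alpha_3,\quad A_4=\frac{\alpha_4-\alpha_3}{2},$$ $$X=\frac1x,\quad Y=-(xy+\alpha_1)x,\quad Z=\frac1z,\quad W=-(zw+\alpha_3)z.$$ Then the system can also be written in the new variables $X,Y,Z,W$ and parameters $A_0,\dots,A_4$ as a Hamiltonian system, and this new system coincides with the system of type $D_5^{(2)}$ $$\frac{dX}{dt}=\frac{\partial H_{D_5^{(2)}}}{\partial Y},\quad \frac{dY}{dt}=-\frac{\partial H_{D_5^{(2)}}}{\partial X},\quad \frac{dZ}{dt}=\frac{\partial H_{D_5^{(2)}}}{\partial W},\quad \frac{dW}{dt}=-\frac{\partial H_{D_5^{(2)}}}{\partial Z}$$ with the Hamiltonian $$tH_{D_5^{(2)}}=X^2Y(Y-t)-X\{2A_0Y+A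_1t\}+Y+Z^2W(W-1)+Z\{(1-2A_4)W-A_3\}+tW-2XZ(XY+A_1)(ZW+A_3).$$
   Context: The system of type $D_4^{(1)}$ is the Hamiltonian system $dx/dt=\partial H/\partial y$, $dy/dt=-\partial H/\partial x$, $dz/dt=\partial H/\partial w$, $dw/dt=-\partial H/\partial z$ with $tH=x^2y(y-1)+x\{(\alpha_0+\alpha_1)y-\alpha_1\}+ty+z^2w(w-t)-z\{(1-\alpha_3-\alpha_4)w+\alpha_3t\}+w-2yw$. The parameters of the system of type $D_5^{(2)}$ satisfy $A_0+A_1+A_2+A_3+A_4=\frac12$. *)

(* Defs.v *)
From HB Require Import structures.
From mathcomp Require Import all_boot all_order all_algebra.
From mathcomp Require Import all_classical all_reals all_analysis.
From mathcomp Require Import complex.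

Set Implicit Arguments.
Unset Strict Implicit.
Unset Printing Implicit Defensive.

Import Order.TTheory GRing.Theory Num.Theory.
Import numFieldNormedType.Exports.

Local Open Scope ring_scope.
Local Open Scope classical_set_scope.

(* [complex R] carries no topology of its own; packed as a numClosedFieldType
   it inherits the topology of the modulus, and [is_derive], [derive1] over it
   are the complex (holomorphic) derivatives. *)
Definition Cplx (R : realType) : numClosedFieldType := complex R.

Section Systems.
Variable R : realType.
Let C := Cplx R.

(* (q1, p1, q2, p2) is a holomorphic solution on U of the time-dependent
   Hamiltonian system with Hamiltonian H t q1 p1 q2 p2 and canonical pairs
   (q1, p1), (q2, p2). *)
Definition hamiltonian_system (H : C -> C -> C -> C -> C -> C)
    (U : set C) (q1 p1 q2 p2 : C -> C) : Prop :=
  forall t : C, U t ->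
  [/\ is_derive t 1 q1 (derive1 (fun s => H t (q1 t) s (q2 t) (p2 t)) (p1 t)),
      is_derive t 1 p1 (- derive1 (fun s => H t s (p1 t) (q2 t) (p2 t)) (q1 t)),
      is_derive t 1 q2 (derive1 (fun s => H t (q1 t) (p1 t) (q2 t) s) (p2 t)) &
      is_derive t 1 p2 (- derive1 (fun s => H t (q1 t) (p1 t) s (p2 t)) (q2 t))].

Definition D4_1_system (a0 a1 a3 a4 : C)
    (U : set C) (x y z w : C -> C) : Prop :=
  forall t : C, U t ->
  [/\ is_derive t 1 x
        ((2 * x t ^+ 2 * y t - x t ^+ 2 + (a0 + a1) * x t - 2 * w t) / t + 1),
      is_derive t 1 y
        ((- 2 * x t * y t ^+ 2 + 2 * x t * y t - (a0 + a1) * y t + a1) / t),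
      is_derive t 1 z
        ((2 * z t ^+ 2 * w t - t * z t ^+ 2 - (1 - a3 - a4) * z t
          + 1 - 2 * y t) / t) &
      is_derive t 1 w
        ((- 2 * z t * w t ^+ 2 + 2 * t * z t * w t + (1 - a3 - a4) * w t
          + a3 * t) / t)].

Definition D5_2_hamiltonian (A0 A1 A3 A4 : C) (t X Y Z W : C) : C :=
  (X ^+ 2 * Y * (Y - t) - X * (2 * A0 * Y + A1 * t) + Y
   + Z ^+ 2 * W * (W - 1) + Z * ((1 - 2 * A4) * W - A3) + t * W
   - 2 * X * Z * (X * Y + A1) * (Z * W + A3)) / t.

Definition D5_2_system (A0 A1 A3 A4 : C) :=
  hamiltonian_system (D5_2_hamiltonian A0 A1 A3 A4).

End Systems.

(* Main.v *)
(* The map (q, p) |-> (1 / q, - (q p + c) q) is an involution, so one derivative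
   computation for it transports solutions in both directions.  In the new
   variables Q (Q P + c) = - p, so the coupling term
   2 X Z (X Y + A1) (Z W + A3) is just 2 y w. What remains is an identity of
   rational functions for each of the four components. *)
Require Import Defs.
From mathcomp Require Import all_boot all_order all_algebra.
From mathcomp Require Import all_classical all_reals all_analysis.
From mathcomp Require Import complex ring.

Import Order.TTheory GRing.Theory Num.Theory.
Import numFieldNormedType.Exports.

Local Open Scope ring_scope.
Local Open Scope classical_set_scope.

(** The Hamiltonian has degree at most two in each variable separately, so this covers all its
    partial derivatives. Writing the constant term as [f 0] means that only the two leading
    coefficients have to be supplied. *)
Lemma derive1_quadratic (K : numFieldType) (f : K -> K) (a b p : K) :
  (forall s, f s = a * s ^+ 2 + b * s + f 0) -> derive1 f p = 2 * a * p + b.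
Proof.
move=> fE; rewrite derive1E.
have -> : f = (a \*: (id ^+ 2)) + (b \*: id) + cst (f 0).
  by apply/funext => s; rewrite [LHS]fE.
rewrite derive_val /GRing.scale /=; ring.
Qed.

(** Since [U] is open, the formulas for [Q] and [P] hold near [t], so the quotient and product rules
    applied to them give the derivatives at [t]. *)
Lemma is_derive_inversion (K : numFieldType) (U : set K) (c : K)
    (q p Q P : K -> K) (t dq dp : K) :
  open U -> (forall s, U s -> Q s = 1 / q s) ->
  (forall s, U s -> P s = - ((q s * p s + c) * q s)) ->
  U t -> q t != 0 -> is_derive t 1 q dq -> is_derive t 1 p dp ->
  is_derive t 1 Q (- dq / q t ^+ 2) /\
  is_derive t 1 P (- ((2 * q t * p t + c) * dq + q t ^+ 2 * dp)).
Proof.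
move=> oU QE PE Ut qt0 dqt dpt.
have nU : \forall s \near t, U s by exact: open_nbhs_nbhs.
split.
  apply: (@near_eq_is_derive _ _ _ (fun s => (q s)^-1)).
    by near=> s; rewrite QE ?div1r//; near: s.
  apply: DeriveDef; first exact: derivableV.
  by rewrite deriveV // derive_val /GRing.scale /= mulNr mulrC mulNr.
apply: (@near_eq_is_derive _ _ _ (- ((q * p + cst c) * q))).
  by near=> s; rewrite PE //; near: s.
apply: is_derive_eq; rewrite /GRing.scale /=.
(* The product of functions is evaluated at [t] by conversion, to leave [ring] an identity in
   [K]. *)
rewrite -[(q * p + cst c) t]/(q t * p t + c); ring.
Unshelve. all: by end_near. Qed.

Arguments is_derive_inversion {K U c q p Q P t dq dp}.

(** Explicit right-hand sides reduce the theorem to comparing rational expressions. The factors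
    [Z t * (Z t * W t + A3)] and [X t * (X t * Y t + A1)] stay unexpanded because they become
    [- w t] and [- y t] under the substitution. *)
Lemma D5_2_systemE (R : realType) (A0 A1 A3 A4 : Cplx R)
    (U : set (Cplx R)) (X Y Z W : Cplx R -> Cplx R) :
  D5_2_system A0 A1 A3 A4 U X Y Z W <->
  forall t, U t ->
  [/\ is_derive t 1 X
        ((2 * X t ^+ 2 * Y t - t * X t ^+ 2 - 2 * A0 * X t + 1
          - 2 * X t ^+ 2 * (Z t * (Z t * W t + A3))) / t),
      is_derive t 1 Y
        (- (2 * X t * Y t * (Y t - t) - 2 * A0 * Y t - A1 * t
          - 2 * (2 * X t * Y t + A1) * (Z t * (Z t * W t + A3))) / t),
      is_derive t 1 Z
        ((2 * Z t ^+ 2 * W t - Z t ^+ 2 + (1 - 2 * A4) * Z t + t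
          - 2 * Z t ^+ 2 * (X t * (X t * Y t + A1))) / t) &
      is_derive t 1 W
        (- (2 * Z t * W t * (W t - 1) + (1 - 2 * A4) * W t - A3
          - 2 * (2 * Z t * W t + A3) * (X t * (X t * Y t + A1))) / t)].
Proof.
rewrite /D5_2_system /hamiltonian_system.
set H := D5_2_hamiltonian A0 A1 A3 A4.
have dY t q1 p1 q2 p2 : derive1 (fun s => H t q1 s q2 p2) p1 =
    (2 * q1 ^+ 2 * p1 - t * q1 ^+ 2 - 2 * A0 * q1 + 1
     - 2 * q1 ^+ 2 * (q2 * (q2 * p2 + A3))) / t.
  (* Here and in the next three computations, the two explicit arguments are the coefficients of
     [s ^+ 2] and [s] in the Hamiltonian. *)
  rewrite (derive1_quadratic _ _ (q1 ^+ 2 / t)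
    ((- t * q1 ^+ 2 - 2 * A0 * q1 + 1
      - 2 * q1 ^+ 2 * (q2 * (q2 * p2 + A3))) / t)).
    ring.
  by move=> s; rewrite /H /D5_2_hamiltonian; ring.
have dX t q1 p1 q2 p2 : - derive1 (fun s => H t s p1 q2 p2) q1 =
    - (2 * q1 * p1 * (p1 - t) - 2 * A0 * p1 - A1 * t
       - 2 * (2 * q1 * p1 + A1) * (q2 * (q2 * p2 + A3))) / t.
  rewrite (derive1_quadratic _ _
    ((p1 * (p1 - t) - 2 * p1 * (q2 * (q2 * p2 + A3))) / t)
    ((- 2 * A0 * p1 - A1 * t - 2 * A1 * (q2 * (q2 * p2 + A3))) / t)).
    ring.
  by move=> s; rewrite /H /D5_2_hamiltonian; ring.
have dW t q1 p1 q2 p2 : derive1 (fun s => H t q1 p1 q2 s) p2 =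
    (2 * q2 ^+ 2 * p2 - q2 ^+ 2 + (1 - 2 * A4) * q2 + t
     - 2 * q2 ^+ 2 * (q1 * (q1 * p1 + A1))) / t.
  rewrite (derive1_quadratic _ _ (q2 ^+ 2 / t)
    ((- q2 ^+ 2 + (1 - 2 * A4) * q2 + t
      - 2 * q2 ^+ 2 * (q1 * (q1 * p1 + A1))) / t)).
    ring.
  by move=> s; rewrite /H /D5_2_hamiltonian; ring.
have dZ t q1 p1 q2 p2 : - derive1 (fun s => H t q1 p1 s p2) q2 =
    - (2 * q2 * p2 * (p2 - 1) + (1 - 2 * A4) * p2 - A3
       - 2 * (2 * q2 * p2 + A3) * (q1 * (q1 * p1 + A1))) / t.
  rewrite (derive1_quadratic _ _
    ((p2 * (p2 - 1) - 2 * p2 * (q1 * (q1 * p1 + A1))) / t)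
    (((1 - 2 * A4) * p2 - A3 - 2 * A3 * (q1 * (q1 * p1 + A1))) / t)).
    ring.
  by move=> s; rewrite /H /D5_2_hamiltonian; ring.
(* Only the four derivative formulas matter from here on; hiding the body of [H] keeps unification
   from unfolding it. *)
clearbody H.
split=> h t /h [h1 h2 h3 h4]; split.
(* Rewriting with the partial derivatives instead makes unification diverge. *)
- by apply: (is_derive_eq h1); exact: dY.
- by apply: (is_derive_eq h2); exact: dX.
- by apply: (is_derive_eq h3); exact: dW.
- by apply: (is_derive_eq h4); exact: dZ.
- by apply: (is_derive_eq h1); exact/esym/dY.
- by apply: (is_derive_eq h2); exact/esym/dX.
- by apply: (is_derive_eq h3); exact/esym/dW.
- by apply: (is_derive_eq h4); exact/esym/dZ.
Qed.

Theorem theorem4p3 (R : realType)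
  (a0 a1 a2 a3 a4 : Cplx R)
  (ha : a0 + a1 + 2 * a2 + a3 + a4 = 1)
  (A0 A1 A2 A3 A4 : Cplx R)
  (hA0 : A0 = (a0 - a1) / 2)
  (hA1 : A1 = a1)
  (hA2 : A2 = a2)
  (hA3 : A3 = a3)
  (hA4 : A4 = (a4 - a3) / 2) :
  A0 + A1 + A2 + A3 + A4 = 1 / 2 /\
  forall (U : set (Cplx R)) (x y z w X Y Z W : Cplx R -> Cplx R),
    open U ->
    (forall t, U t -> [/\ t != 0, x t != 0 & z t != 0]) ->
    (forall t, U t ->
      [/\ X t = 1 / x t,
          Y t = - ((x t * y t + a1) * x t),
          Z t = 1 / z t &
          W t = - ((z t * w t + a3) * z t)]) ->
    D4_1_system a0 a1 a3 a4 U x y z w <-> D5_2_system A0 A1 A3 A4 U X Y Z W.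
Proof.
split.
  rewrite hA0 hA1 hA2 hA3 hA4.
  (* The new parameters sum to half of the old normalization. *)
  by transitivity ((a0 + a1 + 2 * a2 + a3 + a4) / 2); [field|rewrite ha].
move=> U x y z w X Y Z W oU nz XYZW.
have XE s : U s -> X s = 1 / x s by case/XYZW.
have YE s : U s -> Y s = - ((x s * y s + a1) * x s) by case/XYZW.
have ZE s : U s -> Z s = 1 / z s by case/XYZW.
have WE s : U s -> W s = - ((z s * w s + a3) * z s) by case/XYZW.
(* The inverse substitution keeps the constants [a1] and [a3], because [X * Y + a1 = - x * y] and
   [Z * W + a3 = - z * w] on [U]. *)
have xE s : U s -> x s = 1 / X s by move=> Us; rewrite XE // !div1r invrK.
have zE s : U s -> z s = 1 / Z s by move=> Us; rewrite ZE // !div1r invrK.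
have yE s : U s -> y s = - ((X s * Y s + a1) * X s).
  by move=> Us; have [_ x0 _] := nz s Us; rewrite XE // YE //; field.
have wE s : U s -> w s = - ((Z s * W s + a3) * Z s).
  by move=> Us; have [_ _ z0] := nz s Us; rewrite ZE // WE //; field.
rewrite D5_2_systemE hA0 hA1 hA3 hA4; split=> sys t Ut;
  have [t0 x0 z0] := nz t Ut; have [d1 d2 d3 d4] := sys t Ut.
- have [dX dY] := is_derive_inversion oU XE YE Ut x0 d1 d2.
  have [dZ dW] := is_derive_inversion oU ZE WE Ut z0 d3 d4.
  (* The parameters match after a shift: in the first component, for instance, [2 * X ^+ 2 * Y]
     contributes [- 2 * a1 * X], which turns [- (a0 - a1) * X] into [- (a0 + a1) * X]. *)
  by split; apply: is_derive_eq; rewrite ?(XE, YE, ZE, WE) //; field;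
    rewrite ?t0 ?x0 ?z0.
- have X0 : X t != 0 by rewrite XE // div1r invr_eq0.
  have Z0 : Z t != 0 by rewrite ZE // div1r invr_eq0.
  have [dx dy] := is_derive_inversion oU xE yE Ut X0 d1 d2.
  have [dz dw] := is_derive_inversion oU zE wE Ut Z0 d3 d4.
  by split; apply: is_derive_eq; rewrite ?(xE, yE, zE, wE) //; field;
    rewrite ?t0 ?X0 ?Z0.
Qed.
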